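(* For every integer $k\ge 1$, $$P_k(x) = \sum_{T\in\mathcal{T}_k}\mathrm{wt}(T)\, f_{\mathrm{Low}(T);k-1}(x),$$ and consequently $$A_k = P_k(k)=\sum_{T\in\mathcal{T}_k}\mathrm{wt}(T)\,\Pi(\mathrm{Low}(T)+2).$$
   Context: The polynomials $P_k(x)$, $k\ge 1$, are defined recursively by $P_1(x)=1$ and, for $k\ge 1$, $$P_{k+1}(x) = \frac{P_k(k)\prod_{i=1}^{k}(2x-2k+2i+1)-\left(\prod_{i=1}^{k}(2i+1)\right)P_k(x)}{2x-2k};$$ this is a polynomial because the numerator vanishes at $x=k$ (the quotient is taken as polynomials in $x$). Put $A_k=P_k(k)$. For an integer $k\ge1$ let $R(k)=\{3,5,7,\dots,2k+1\}$, and $R(0)=\emptyset$. For a finite set $S$ of integers and an integer $m$, $S+m=\{s+m: s\in S\}$ and $\Pi S=\prod_{s\in S}s$ (with $\Pi\emptyset=1$); a difference of sets $A-B$ denotes the set difference. Let $f_{S;k}(x)=\prod_{s\in S}(2x-2k+s)$ (equal to $1$ if $S=\emptyset$). $\mathcal{T}_k$ is the set of plane trees (rooted trees in which the children of each vertex are linearly ordered) with $k$ vertices. A vertex is at level $i$ if the path from it to the root has $i$ edges. To each $T\in\mathcal{T}_k$ one associates finite sets of integers $\mathrm{Low}(T)$, $\mathrm{High}(T)$ and a weight $\mathrm{wt}(T)$ recursively. If $k\in\{1,2\}$, then $\mathrm{Low}(T)=\mathrm{High}(T)=\emptyset$ and $\mathrm{wt}(T)=1$. If $k\ge 3$, let $v$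 be the last vertex of $T$ in the preorder traversal, let $i$ be the level of $v$ (so $1\le i\le k-1$), and let $T'=T\setminus v\in\mathcal{T}_{k-1}$. Then: - $\mathrm{Low}(T)$ consists of the elements of $\mathrm{Low}(T')+2$ together with the $k-i-1-|\mathrm{Low}(T')|$ smallest elements of $R(k-2)-(\mathrm{Low}(T')+2)$ (so that $|\mathrm{Low}(T)|=k-i-1$); - $\mathrm{High}(T)$ consists of the elements of $\mathrm{Low}(T')+2$ together with the $i-1$ greatest elements of $(R(k-2)+2)-(\mathrm{Low}(T')+2)$; - $\mathrm{wt}(T)=\mathrm{wt}(T')\,\Pi(\mathrm{High}(T))$. *)

(* Defs.v *)
From HB Require Import structures.
From mathcomp Require Import all_boot all_order all_algebra finmap.

Set Implicit Arguments.
Unset Strict Implicit.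
Unset Printing Implicit Defensive.

Import Order.TTheory GRing.Theory Num.Theory.
Local Open Scope fset_scope.
Local Open Scope ring_scope.

(* [%/] is Euclidean division in {poly rat}; the numerator vanishes at k, so
   the division is exact. The value at index 0 is a dummy. *)
Fixpoint P (k : nat) : {poly rat} :=
  match k with
  | (_.+1 as k').+1 =>
      ((P k').[k'%:R] *: \prod_(1 <= i < k'.+1)
                           (2%:R *: 'X - (2 * k')%N%:R%:P + (2 * i + 1)%N%:R%:P)
       - (\prod_(1 <= i < k'.+1) (2 * i + 1)%N%:R) *: P k')
      %/ (2%:R *: 'X - (2 * k')%N%:R%:P)
  | _ => 1
  end.

Definition A (k : nat) : rat := (P k).[k%:R].

Inductive ptree := Node of seq ptree.

(* A vertex is the sequence of child indices leading to it from the root, so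
   that its level is the size of this sequence. *)
Fixpoint preorder (T : ptree) : seq (seq nat) :=
  let: Node ts := T in
  [::] :: flatten [seq [seq ip.1 :: v | v <- ip.2]
                  | ip <- zip (iota 0 (size ts)) [seq preorder t | t <- ts]].

Definition nvertices (T : ptree) : nat := size (preorder T).

Definition last_vertex (T : ptree) : seq nat := last [::] (preorder T).

(* Removes the subtree rooted at v, that is, only v itself when v is a leaf, as
   is the last vertex in preorder. The root is never removed. *)
Fixpoint remove_vertex (v : seq nat) (T : ptree) : ptree :=
  let: Node ts := T in
  match v with
  | [::] => T
  | [:: i] => Node (take i ts ++ drop i.+1 ts)
  | i :: v' =>
      Node (set_nth (Node [::]) ts i (remove_vertex v' (nth (Node [::]) ts i)))
  end.

Definition remove_last (T : ptree) : ptree := remove_vertex (last_vertex T) T.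

Definition R (k : nat) : {fset int} :=
  [fset (2 * i + 1)%N%:Z | i in iota 1 k].

Definition shift (S : {fset int}) (m : int) : {fset int} :=
  [fset s + m | s in S].

Definition Pi (S : {fset int}) : int := \prod_(s <- S) s.

Definition f (S : {fset int}) (k : nat) : {poly rat} :=
  \prod_(s <- S) (2%:R *: 'X - (2 * k)%N%:R%:P + s%:~R%:P).

Definition smallest (n : nat) (S : {fset int}) : {fset int} :=
  [fset s in take n (sort <=%R S)].

Definition greatest (n : nat) (S : {fset int}) : {fset int} :=
  [fset s in take n (sort >=%R S)].

(* In [low], [high] and [weight], k is the number of vertices of T and i the
   level of its last vertex. The level of the last vertex of [remove_last T] is
   at least i - 1, so the natural number subtractions below do not truncate. *)
Fixpoint low (k : nat) (T : ptree) : {fset int} :=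
  match k with
  | (_.+2 as k').+1 =>
      let i := size (last_vertex T) in
      let L := low k' (remove_last T) in
      shift L 2 `|` smallest (k - i - 1 - #|` L|)%N (R (k - 2)%N `\` shift L 2)
  | _ => fset0
  end.

Definition high (k : nat) (T : ptree) : {fset int} :=
  match k with
  | (_.+2 as k').+1 =>
      let i := size (last_vertex T) in
      let L := low k' (remove_last T) in
      shift L 2 `|` greatest (i - 1)%N (shift (R (k - 2)%N) 2 `\` shift L 2)
  | _ => fset0
  end.

Fixpoint weight (k : nat) (T : ptree) : int :=
  match k with
  | (_.+2 as k').+1 => weight k' (remove_last T) * Pi (high k T)
  | _ => 1
  end.

Definition Low (T : ptree) : {fset int} := low (nvertices T) T.
Definition High (T : ptree) : {fset int} := high (nvertices T) T.
Definition wt (T : ptree) : int := weight (nvertices T) T.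

Fixpoint ptree_to_gen (T : ptree) : GenTree.tree void :=
  let: Node ts := T in GenTree.Node 0 (map ptree_to_gen ts).

Fixpoint gen_to_ptree (g : GenTree.tree void) : ptree :=
  if g is GenTree.Node _ gs then Node (map gen_to_ptree gs) else Node [::].

Lemma ptree_to_genK : cancel ptree_to_gen gen_to_ptree.
Proof.
rewrite /cancel; fix IH 1 => -[ts] /=; congr Node; rewrite -map_comp.
by elim: ts => //= t ts ->; rewrite IH.
Qed.

HB.instance Definition _ := Countable.copy ptree (can_type ptree_to_genK).

Record plane_tree (k : nat) := PlaneTree {
  ptree_val :> ptree;
  _ : nvertices ptree_val == k }.

HB.instance Definition _ k := [isSub for @ptree_val k].
HB.instance Definition _ k := [Countable of plane_tree k by <:].

(* All forests with n <= d vertices in total; d is only a recursion bound. *)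
Fixpoint forests (d n : nat) : seq (seq ptree) :=
  match d, n with
  | d'.+1, n'.+1 =>
      flatten [seq [seq Node s :: ts | s <- forests d' a, ts <- forests d' (n' - a)]
              | a <- iota 0 n'.+1]
  | _, _ => [:: [::]]
  end.

Lemma nvertices_Node ts :
  nvertices (Node ts) = (sumn [seq nvertices t | t <- ts]).+1.
Proof.
rewrite /nvertices /=; congr _.+1; rewrite size_flatten /shape -map_comp.
congr sumn; elim: ts 0%N => //= t ts IH m.
by rewrite size_map IH.
Qed.

Lemma forests_complete d ts :
  (sumn [seq nvertices t | t <- ts] <= d)%N ->
  ts \in forests d (sumn [seq nvertices t | t <- ts]).
Proof.
elim: d ts => [|d IH] [|[s] ts] //; rewrite [map _ _]/= [sumn _]/=.
rewrite nvertices_Node addSn ltnS => le_d.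
apply/flatten_mapP; exists (sumn [seq nvertices t | t <- s]).
  by rewrite mem_iota ltnS leq_addr.
apply/allpairsP; exists (s, ts); rewrite addKn; split => //; apply: IH.
  exact: leq_trans (leq_addr _ _) le_d.
exact: leq_trans (leq_addl _ _) le_d.
Qed.

Definition plane_tree_enum k : seq (plane_tree k) :=
  undup (pmap insub [seq Node ts | ts <- forests k.-1 k.-1]).

Lemma mem_plane_tree_enum k : plane_tree_enum k =i {: plane_tree k}.
Proof.
case=> -[ts] Tk; rewrite mem_undup mem_pmap_sub /= inE map_f //.
have := Tk; rewrite nvertices_Node => /eqP <-; exact: forests_complete.
Qed.

HB.instance Definition _ k := isFinite.Build (plane_tree k)
  (Finite.uniq_enumP (undup_uniq _) (@mem_plane_tree_enum k)).

(* Main.v *)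
Require Import Defs.
From mathcomp Require Import all_boot all_order all_algebra finmap.
From mathcomp Require Import ring zify.

(** Both sides grow by the same recursion.  A tree with k+1 vertices is a tree T
with k vertices together with a new last vertex; if the last vertex of T is at
level l, the new one can be put at any of the levels 1, ..., l+1
([sum_plane_treeS]).

Put y = 2x - 2k and L = Low(T) + 2, and call the elements r_0 < ... < r_l of
R(k) - L free; there are l+1 of them, because |Low(T)| = k - l - 1.  They start
with 3 and end with 2k+1, so that the sets R(k-1) - L and (R(k-1) + 2) - L in
the definitions of Low and High consist of the free elements except,
respectively, the last one and the first one.  Hence putting the new vertex at
level l - j + 1 adds r_0, ..., r_(j-1) to L to form Low, and adds
r_(j+1), ..., r_l to form High ([perm_Low_add_last], [wt_add_last_free]): only
r_j is left out.

In terms of y, the summand of T in P_k is wt(T) times the product of y + s over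
s in L, and its value at x = k, that is at y = 0, is wt(T) Pi(L)
([f_shift], [horner_f]).  Splitting R(k) into L and the free elements, the
contribution of T to the numerator in the recursion for P_(k+1) is
  wt(T) Pi(L) prod_(s in L) (y + s) (prod_j (y + r_j) - prod_j r_j),
and the last factor telescopes ([telescope_prod]) to
  y sum_j (y + r_0) ... (y + r_(j-1)) r_(j+1) ... r_l.
Division by y leaves exactly the sum over the l+1 trees grown from T
([sum_children]). *)

Import Order.TTheory GRing.Theory Num.Theory.
Local Open Scope fset_scope.
Local Open Scope ring_scope.

Set Implicit Arguments.
Unset Strict Implicit.
Unset Printing Implicit Defensive.

(** * Growing plane trees at the last vertex *)

Local Notation leaf := (Node [::]).

Definition level (T : ptree) : nat := size (last_vertex T).

(** The last vertex in preorder lies in the last child subtree, so every fact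
about it follows by induction along the rightmost branch. *)
Lemma ptree_rcons_ind (Q : ptree -> Prop) :
  Q leaf -> (forall ts t, Q t -> Q (Node (rcons ts t))) -> forall T, Q T.
Proof.
move=> Q0 Qr T; have [n] := ubnP (nvertices T); elim: n T => // n IH [ts].
case/lastP: ts => [|ts t] // ltn; apply/Qr/IH.
move: ltn; rewrite nvertices_Node map_rcons sumn_rcons ltnS.
by apply: leq_ltn_trans; rewrite leq_addl.
Qed.

Lemma nvertices_rcons ts t :
  nvertices (Node (rcons ts t)) = (nvertices (Node ts) + nvertices t)%N.
Proof. by rewrite !nvertices_Node map_rcons sumn_rcons. Qed.

Lemma nvertices_gt0 T : (0 < nvertices T)%N.
Proof. by case: T => ts; rewrite nvertices_Node. Qed.

Lemma last_vertex_rcons ts t :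
  last_vertex (Node (rcons ts t)) = size ts :: last_vertex t.
Proof.
rewrite /last_vertex /= map_rcons size_rcons -cats1 -[(size ts).+1]addn1 iotaD add0n /=.
rewrite zip_cat ?size_iota ?size_map // map_cat flatten_cat /= cats0 last_cat.
by case: t => us /=; rewrite last_map.
Qed.

Lemma level_rcons ts t : level (Node (rcons ts t)) = (level t).+1.
Proof. by rewrite /level last_vertex_rcons. Qed.

Lemma remove_last_rcons ts t :
  remove_last (Node (rcons ts t)) =
  if level t is 0 then Node ts else Node (rcons ts (remove_last t)).
Proof.
rewrite /remove_last /level last_vertex_rcons.
case Dv: (last_vertex t) => [|i v].
  rewrite /= -cats1 take_size_cat // drop_oversize ?cats0 //.
  by rewrite size_cat addn1.
by rewrite [remove_vertex _ _]/= nth_rcons ltnn eqxx; congr Node;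
   elim: ts => //= t' ts ->.
Qed.

(** The new vertex becomes the last child of the vertex at level [d] of the
rightmost branch, hence has level [d.+1].  The branch ends at the last vertex, so
this makes sense for [d <= level T]; beyond that the value is a dummy. *)
Fixpoint add_last (d : nat) (T : ptree) : ptree :=
  let: Node ts := T in
  match d with
  | 0 => Node (rcons ts leaf)
  | d'.+1 =>
      if rev ts is t :: us then Node (rcons (rev us) (add_last d' t)) else T
  end.

Lemma add_lastS d ts t :
  add_last d.+1 (Node (rcons ts t)) = Node (rcons ts (add_last d t)).
Proof. by rewrite /= rev_rcons revK. Qed.

Lemma level_eq0 T : level T = 0%N -> T = leaf.
Proof. by case: T => ts; case/lastP: ts => // ts t; rewrite level_rcons. Qed.

Lemma level_add_last d T :
  (d <= level T)%N -> level (add_last d T) = d.+1.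
Proof.
elim/ptree_rcons_ind: T d => [|ts t IH] [|d] //; rewrite ?level_rcons //.
by rewrite add_lastS level_rcons ltnS => /IH ->.
Qed.

Lemma add_lastK d T :
  (d <= level T)%N -> remove_last (add_last d T) = T.
Proof.
elim/ptree_rcons_ind: T d => [|ts t IH] [|d] //.
  by move=> _; rewrite [add_last _ _]/= remove_last_rcons.
rewrite level_rcons ltnS => le_d; rewrite add_lastS remove_last_rcons.
by rewrite level_add_last // IH.
Qed.

Lemma remove_lastK T d :
  level T = d.+1 -> add_last d (remove_last T) = T.
Proof.
elim/ptree_rcons_ind: T d => [|ts t IH] // d; rewrite level_rcons => -[Dd].
rewrite remove_last_rcons Dd; case: d Dd => [|d] Dd.
  by rewrite (level_eq0 Dd).
by rewrite add_lastS IH.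
Qed.

(** The parent of the last vertex stays on the rightmost branch, which may grow
longer: the last vertex of what remains can be deeper than the removed one. *)
Lemma level_remove_last T d :
  level T = d.+1 -> (d <= level (remove_last T))%N.
Proof.
elim/ptree_rcons_ind: T d => [|ts t IH] // d; rewrite level_rcons => -[Dd].
rewrite remove_last_rcons Dd; case: d Dd => [|d] Dd //.
by rewrite level_rcons ltnS IH.
Qed.

Lemma nvertices_add_last d T :
  (d <= level T)%N -> nvertices (add_last d T) = (nvertices T).+1.
Proof.
elim/ptree_rcons_ind: T d => [|ts t IH] [|d] //.
  by move=> _; rewrite [add_last _ _]/= (nvertices_rcons (rcons ts t)) addn1.
by rewrite level_rcons ltnS => /IH Dt; rewrite add_lastS !nvertices_rcons Dt addnS.
Qed.

Lemma level_prednK T : (1 < nvertices T)%N -> level T = (level T).-1.+1.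
Proof.
by case: (level T) (@level_eq0 T) => // /(_ erefl) ->.
Qed.

Lemma nvertices_remove_last T :
  (1 < nvertices T)%N -> (nvertices (remove_last T)).+1 = nvertices T.
Proof.
move=> /level_prednK DT; rewrite -[in RHS](remove_lastK DT) nvertices_add_last //.
exact: level_remove_last.
Qed.

Lemma level_lt T : (level T < nvertices T)%N.
Proof.
elim/ptree_rcons_ind: T => [|ts t IH] //.
rewrite level_rcons nvertices_rcons.
exact: leq_add (nvertices_gt0 _) IH.
Qed.

(** Generating trees by new last vertices matches the recursion that defines
[Low], [High] and [wt]. *)
Lemma ptree_grow_ind (Q : ptree -> Prop) :
  Q leaf ->
  (forall d T, (d <= level T)%N -> Q T -> Q (add_last d T)) ->
  forall T, Q T.
Proof.
move=> Q0 QS T; have [n] := ubnP (nvertices T); elim: n T => // n IH T ltTn.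
case DT: (level T) => [|d]; first by rewrite (level_eq0 DT).
rewrite -(remove_lastK DT); apply: QS; first exact: level_remove_last.
apply: IH; rewrite -ltnS (leq_trans _ ltTn) // ltnS nvertices_remove_last //.
by rewrite (leq_trans _ (level_lt T)) // DT.
Qed.

Lemma plane_treeP k (T : plane_tree k) : nvertices T = k.
Proof. by apply/eqP/(valP T). Qed.

(** The trees [U] with [remove_last U] equal to [T] are exactly the
[add_last d T], each determined by the level of its last vertex. *)
Lemma sum_plane_treeS k (V : nmodType) (F : ptree -> V) : (0 < k)%N ->
  \sum_(T : plane_tree k.+1) F T =
  \sum_(T : plane_tree k) \sum_(d < (level T).+1) F (add_last d T).
Proof.
move=> k_gt0.
have rem_subproof (T : plane_tree k.+1) : nvertices (remove_last T) == k.
  by rewrite -eqSS nvertices_remove_last plane_treeP.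
pose rem T := PlaneTree (rem_subproof T).
rewrite (partition_big rem predT) //=; apply: eq_bigr => T _.
have add_subproof (d : 'I_(level T).+1) : nvertices (add_last d T) == k.+1.
  by rewrite nvertices_add_last ?plane_treeP // -ltnS.
pose add d := PlaneTree (add_subproof d).
have remE (U : plane_tree k.+1) : rem U = T -> remove_last U = T by move=> <-.
(* The inverse reads d off the level of the last vertex, which is d.+1. *)
rewrite (reindex_onto add (fun U => inord (level U).-1)) /=.
  apply: eq_bigl => d; have le_d : (d <= level T)%N by rewrite -ltnS.
  rewrite -val_eqE /= add_lastK // eqxx level_add_last //=.
  by rewrite inord_val eqxx.
move=> U /eqP/remE DU; apply: val_inj => /=.
have DL : level U = (level U).-1.+1 by apply: level_prednK; rewrite plane_treeP.
rewrite inordK ?ltnS -DU; first exact: remove_lastK.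
exact: level_remove_last.
Qed.

(** * Sets of integers and their sorted enumerations *)

Lemma mem_R k x :
  reflect (exists2 i, (0 < i <= k)%N & x = (2 * i + 1)%N%:Z) (x \in R k).
Proof.
rewrite /R; apply: (iffP (imfsetP _ _ _ _)) => -[i iI ->]; exists i => //.
  by move: iI; rewrite /= mem_iota add1n ltnS.
by rewrite mem_iota add1n ltnS.
Qed.

Lemma R_S k : R k.+1 = (2 * k.+1 + 1)%N%:Z |` R k.
Proof.
apply/fsetP => x; rewrite in_fset1U; apply/mem_R/predU1P.
  move=> [i /andP[i_gt0]]; rewrite leq_eqVlt ltnS => /predU1P[-> ->|le_i ->].
    by left.
  by right; apply/mem_R; exists i; rewrite ?i_gt0.
case=> [->|/mem_R[i /andP[i_gt0 /leqW le_i] ->]]; first by exists k.+1; rewrite ?leqnn.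
by exists i; rewrite ?i_gt0.
Qed.

Lemma R0 : R 0 = fset0.
Proof. by apply/fsetP=> x; apply/mem_R; case=> -[]. Qed.

Lemma card_R k : #|` R k| = k.
Proof.
rewrite /R card_imfset /=; last first.
  by move=> i j [] /eqP; rewrite eqn_add2r eqn_mul2l => /eqP.
by rewrite undup_id ?iota_uniq // size_iota.
Qed.

Lemma prod_R (V : comPzRingType) (F : int -> V) k :
  \prod_(1 <= i < k.+1) F (2 * i + 1)%N%:Z = \prod_(s <- R k) F s.
Proof.
elim: k => [|k IH]; first by rewrite big_geq // R0 big_nil.
rewrite big_nat_recr; last by [].
rewrite IH R_S big_fsetU1; first exact: mulrC.
by apply/negP => /mem_R[i le_i]; lia.
Qed.

Lemma card_shift (S : {fset int}) m : #|` shift S m| = #|` S|.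
Proof. by rewrite card_imfset //=; apply: addIr. Qed.

Lemma big_shift (V : comPzSemiRingType) (F : int -> V) (S : {fset int}) m :
  \prod_(s <- shift S m) F s = \prod_(s <- S) F (s + m).
Proof. by rewrite big_imfset //= => x y _ _; apply: addIr. Qed.

Lemma shift_fset0 m : shift fset0 m = fset0.
Proof. by apply/fsetP => x; rewrite inE; apply/imfsetP => -[]. Qed.

Lemma sort_cons_min (x : int) (S : {fset int}) :
  {in S, forall y, x < y} -> sort <=%R (x |` S) = x :: sort <=%R S.
Proof.
move=> xS; apply: le_sorted_eq; first exact: sort_le_sorted.
  rewrite /= path_min_sorted ?sort_le_sorted //.
  by apply/allP => y; rewrite mem_sort => /xS/ltW.
rewrite perm_sort; apply: uniq_perm => [||y].
- exact: fset_uniq.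
- rewrite /= mem_sort sort_uniq fset_uniq andbT.
  by apply/negP => /xS; rewrite ltxx.
by rewrite !inE mem_sort.
Qed.

Lemma sort_rcons_max (x : int) (S : {fset int}) :
  {in S, forall y, y < x} -> sort <=%R (x |` S) = rcons (sort <=%R S) x.
Proof.
move=> xS; apply: le_sorted_eq; first exact: sort_le_sorted.
  rewrite -rev_sorted rev_rcons /= path_min_sorted ?rev_sorted ?sort_le_sorted //.
  by apply/allP => y; rewrite mem_rev mem_sort => /xS/ltW.
rewrite perm_sort; apply: uniq_perm => [||y].
- exact: fset_uniq.
- rewrite rcons_uniq mem_sort sort_uniq fset_uniq andbT.
  by apply/negP => /xS; rewrite ltxx.
by rewrite mem_rcons !inE mem_sort.
Qed.

Lemma sort_ge (S : {fset int}) : sort >=%R S = rev (sort <=%R S).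
Proof.
apply: (@sorted_eq _ >=%R) => [||||].
- by move=> y x z /= xy yz; apply: le_trans yz xy.
- by move=> x y /=; rewrite andbC; apply: le_anti.
- by apply: sort_sorted => x y; apply: le_total.
- by rewrite rev_sorted; apply: sort_le_sorted.
by rewrite perm_sort perm_sym perm_rev perm_sort.
Qed.

Lemma sort_fset0 (leT : rel int) : sort leT fset0 = [::].
Proof. by apply/nilP; rewrite /nilp size_sort cardfs0. Qed.

Lemma smallest_fset0 n : smallest n fset0 = fset0.
Proof. by apply/fsetP => x; rewrite /smallest sort_fset0 in_fset in_fset0. Qed.

Lemma greatest_fset0 n : greatest n fset0 = fset0.
Proof. by apply/fsetP => x; rewrite /greatest sort_fset0 in_fset in_fset0. Qed.

Lemma perm_fsetU_seq (S : {fset int}) (t : seq int) :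
  uniq t -> {in t, forall x, x \notin S} ->
  perm_eq (S `|` [fset x in t]) (S ++ t).
Proof.
move=> t_uniq tS; apply: uniq_perm => [||x]; first exact: fset_uniq.
  rewrite cat_uniq fset_uniq t_uniq andbT /=.
  by apply/hasPn => x /tS.
by rewrite mem_cat in_fsetU in_fset.
Qed.

(** * Low, High and weight of a grown tree *)

(** [low] and [weight] take the number of vertices as their recursion argument;
these equations unfold exactly one step and leave the sets uncomputed. *)
Lemma low_step k T (L := shift (low k.+2 (remove_last T)) 2) :
  low k.+3 T =
  L `|` smallest (k.+3 - level T - 1 - #|` low k.+2 (remove_last T)|)
          (R k.+1 `\` L).
Proof. by []. Qed.

Lemma weight_step k T (L := shift (low k.+2 (remove_last T)) 2) :
  weight k.+3 T = weight k.+2 (remove_last T) *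
    Pi (L `|` greatest (level T - 1) (shift (R k.+1) 2 `\` L)).
Proof. by []. Qed.

Section Grow.
Variables (d : nat) (T : ptree).
Hypothesis le_d : (d <= level T)%N.
Let k := nvertices T.
Let L := shift (Low T) 2.

(** This form also covers a one-vertex tree [T], where both sides are empty, so
the two-vertex tree needs no special treatment. *)
Lemma Low_add_last :
  Low (add_last d T) =
  L `|` smallest (k - d.+1 - #|` Low T|) (R k.-1 `\` L).
Proof.
rewrite /L /Low nvertices_add_last // -/k.
case: k (nvertices_gt0 T : (0 < k)%N) => [/notF []|[|n] _].
  by rewrite shift_fset0 fset0U R0 fset0D smallest_fset0.
rewrite low_step add_lastK // level_add_last //.
by have -> : (n.+3 - d.+1 - 1 = n.+2 - d.+1)%N by lia.
Qed.

Lemma wt_add_last :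
  wt (add_last d T) = wt T * Pi (L `|` greatest d (shift (R k.-1) 2 `\` L)).
Proof.
rewrite /L /wt /Low nvertices_add_last // -/k.
case: k (nvertices_gt0 T : (0 < k)%N) => [/notF []|[|n] _].
  by rewrite shift_fset0 fset0U R0 shift_fset0 fset0D greatest_fset0 /Pi big_nil.
by rewrite weight_step add_lastK // level_add_last // subn1.
Qed.

End Grow.

(** The cardinality says that there are always as many elements to choose from
as the definition of [Low] asks for: [R k.-1] without [Low T + 2] has exactly
[level T] elements, of which [level T - d] are taken. *)
Lemma Low_sub_card T (k := nvertices T) :
  Low T `<=` R (k - 2) /\ (#|` Low T| + level T).+1 = k.
Proof.
rewrite {}/k; elim/ptree_grow_ind: T => [|d T le_d [sub_T card_T]].
  by rewrite [Low _]/(fset0) fsub0set cardfs0.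
set k := nvertices T in sub_T card_T *.
have sub_L : shift (Low T) 2 `<=` R k.-1.
  apply/fsubsetP => _ /imfsetP[x /= /(fsubsetP sub_T)/mem_R[i le_i ->] ->].
  apply/mem_R; exists i.+1; lia.
rewrite Low_add_last // nvertices_add_last // level_add_last // -/k.
split.
  rewrite subSS subn1 fsubUset sub_L /=.
  apply/fsubsetP => x; rewrite in_fset => /mem_take.
  by rewrite mem_sort in_fsetD => /andP[].
rewrite (perm_size (perm_fsetU_seq _ _)).
- rewrite size_cat card_shift size_take size_sort cardfsDS // card_R card_shift.
  case: ifP; lia.
- by rewrite take_uniq // sort_uniq fset_uniq.
by move=> x /mem_take; rewrite mem_sort in_fsetD => /andP[].
Qed.

(** In this section [r] lists in increasing order the elements of [R k] that are
free, that is, outside [L]. *)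
Section Children.
Variable T : ptree.
Let k := nvertices T.
Let L := shift (Low T) 2.
Let r := sort <=%R (R k `\` L).

Let k_gt0 : (0 < k)%N. Proof. exact: nvertices_gt0. Qed.

(** The strict bounds exclude 3 and 2k+1 from [L]: these are always the smallest
and the greatest free element. *)
Lemma in_shift_Low x :
  x \in L -> exists2 i, (1 < i < k)%N & x = (2 * i + 1)%N%:Z.
Proof.
have [/fsubsetP sub_T _] := Low_sub_card T.
case/imfsetP => y /= /sub_T/mem_R[i le_i ->] ->; exists i.+1; lia.
Qed.

Lemma free_rcons : r = rcons (sort <=%R (R k.-1 `\` L)) (2 * k + 1)%N%:Z.
Proof.
rewrite -sort_rcons_max => [|x]; last first.
  by rewrite in_fsetD => /andP[_ /mem_R[i le_i ->]]; lia.
congr (sort _ (enum_fset _)); apply/fsetP => x.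
rewrite -{1 2}(prednK k_gt0) R_S !(in_fset1U, in_fsetD).
have [/in_shift_Low[i lt_i ->] | _] //= := boolP (x \in L).
by rewrite orbF; apply/esym/eqP; lia.
Qed.

Lemma free_cons : r = 3 :: sort <=%R (shift (R k.-1) 2 `\` L).
Proof.
rewrite -sort_cons_min => [|x]; last first.
  by rewrite in_fsetD => /andP[_ /imfsetP[y /= /mem_R[i le_i ->] ->]]; lia.
congr (sort _ (enum_fset _)); apply/fsetP => x; rewrite in_fset1U !in_fsetD.
have [/in_shift_Low[i lt_i ->] | _] /= := boolP (x \in L).
  by rewrite orbF; apply/esym/eqP; lia.
apply/mem_R/predU1P.
  case=> -[|[|i]] // le_i ->; [by left | right].
  by apply/imfsetP; exists (2 * i.+1 + 1)%N%:Z; [apply/mem_R; exists i.+1|]; lia.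
case=> [->|/imfsetP[y /= /mem_R[i le_i ->] ->]]; first by exists 1%N.
exists i.+1; lia.
Qed.

Lemma size_free : size r = (level T).+1.
Proof.
have [_ card_T] := Low_sub_card T.
rewrite free_rcons size_rcons size_sort cardfsDS; last first.
  apply/fsubsetP => _ /in_shift_Low[i lt_i ->]; apply/mem_R; exists i; lia.
rewrite card_R card_shift; move: card_T; rewrite -/k; lia.
Qed.

Variable d : nat.
Hypothesis le_d : (d <= level T)%N.
Let j := (level T - d)%N.

(** The elements that [Low] gains are taken from [R k.-1], which lacks 2k+1; since
[j <= level T], that last free element is not reached in [r] either. *)
Lemma perm_Low_add_last : perm_eq (Low (add_last d T)) (L ++ take j r).
Proof.
have [_ card_T] := Low_sub_card T.
rewrite Low_add_last // -/k -/L.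
have -> : (k - d.+1 - #|` Low T| = j)%N by rewrite /k /j; lia.
rewrite free_rcons -cats1 takel_cat; last first.
  by move: size_free; rewrite free_rcons size_rcons => -[->]; rewrite leq_subr.
apply: perm_fsetU_seq => [|x /mem_take].
  by rewrite take_uniq // sort_uniq fset_uniq.
by rewrite mem_sort in_fsetD => /andP[].
Qed.

(** Dually, [High] gains the [d] greatest elements of a set that lacks only the
first free element 3; they are the last [d] entries of [r], which start right
after position [j]. *)
Lemma wt_add_last_free :
  wt (add_last d T) = wt T * (Pi L * \prod_(s <- drop j.+1 r) s).
Proof.
rewrite wt_add_last // -/k -/L /greatest sort_ge take_rev /Pi; congr (_ * _).
rewrite (perm_big _ (perm_fsetU_seq _ _)) => [||x].
- rewrite big_cat /=; congr (_ * _); rewrite (perm_big _ (permEl (perm_rev _))).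
  by move: size_free; rewrite free_cons /= => -[->].
- by rewrite rev_uniq drop_uniq // sort_uniq fset_uniq.
by rewrite mem_rev => /mem_drop; rewrite mem_sort in_fsetD => /andP[].
Qed.

End Children.

(** * The recursion for P *)

(** Changing the factors [y + c a] into [c a] one at a time, from the right end,
each step changes the product by [y] times the other factors. *)
Lemma telescope_prod (V : comPzRingType) (I : Type) (y : V) (c : I -> V) r :
  \prod_(a <- r) (y + c a) - \prod_(a <- r) c a =
  y * \sum_(j < size r)
        (\prod_(a <- take j r) (y + c a) * \prod_(a <- drop j.+1 r) c a).
Proof.
elim: r => [|a r IH]; first by rewrite !big_nil big_ord0 mulr0 subrr.
rewrite [size _]/= big_ord_recl take0 big_nil mul1r drop1 [behead _]/=.
rewrite (eq_bigr (fun j : 'I_(size r) => (y + c a) *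
    (\prod_(b <- take j r) (y + c b) * \prod_(b <- drop j.+1 r) c b))).
  by rewrite -mulr_sumr mulrDr mulrCA -IH !big_cons; ring.
by move=> j _; rewrite lift0 [take _ _]/= big_cons -mulrA.
Qed.

(** With [y = 2x - 2k], the left-hand side is the contribution of [T] to the
numerator of the recursion for [P k.+1]. *)
Lemma sum_children (T : ptree) (k := nvertices T) (L := shift (Low T) 2)
    (y : {poly rat}) (c := fun s : int => s%:~R%:P : {poly rat}) :
  (wt T * Pi L)%:~R *: \prod_(s <- R k) (y + c s)
    - (\prod_(s <- R k) s%:~R) *: ((wt T)%:~R *: \prod_(s <- L) (y + c s)) =
  y * \sum_(d < (level T).+1)
        (wt (add_last d T))%:~R *: \prod_(s <- Low (add_last d T)) (y + c s).
Proof.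
pose r := sort <=%R (R k `\` L).
have perm_R : perm_eq (R k) (L ++ r).
  apply: uniq_perm => [||x]; first exact: fset_uniq.
    rewrite cat_uniq !(fset_uniq, sort_uniq) andbT /=.
    by apply/hasPn => x; rewrite mem_sort in_fsetD => /andP[].
  rewrite mem_cat mem_sort in_fsetD.
  have [/in_shift_Low[i lt_i ->] | _] //= := boolP (x \in L).
  by apply/mem_R; exists i => //; rewrite -/k in lt_i; lia.
have cM (s : seq int) : \prod_(a <- s) c a = (\prod_(a <- s) a)%:~R%:P.
  by rewrite /c rmorph_prod /= rmorph_prod.
(* Level d.+1 leaves out the free element of index j = level T - d. *)
rewrite (reindex_inj rev_ord_inj) /=.
rewrite (eq_bigr (fun j : 'I_(level T).+1 => (wt T * Pi L)%:~R *:
    (\prod_(s <- L) (y + c s) *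
     (\prod_(s <- take j r) (y + c s) * \prod_(s <- drop j.+1 r) c s)))); last first.
  move=> j _; have le_j : (j <= level T)%N by rewrite -ltnS.
  have le_d : (level T - j <= level T)%N by rewrite leq_subr.
  rewrite subSS wt_add_last_free // (perm_big _ (perm_Low_add_last le_d)).
  rewrite subKn // big_cat /= cM mulrA [in LHS]rmorphM /= -scalerA; congr (_ *: _).
  by rewrite -mul_polyC; ring.
rewrite -scaler_sumr -mulr_sumr -size_free -scalerAr mulrCA -telescope_prod.
rewrite !(perm_big _ perm_R) !big_cat /= cM rmorphM /= -!mul_polyC.
rewrite /Pi !rmorphM /= !rmorph_prod /=; ring.
Qed.

(** The shift by 2 absorbs the change of centre from [k - 1] to [k]. *)
Lemma f_shift (S : {fset int}) k : (0 < k)%N ->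
  f S (k - 1) =
  \prod_(s <- shift S 2) (2%:R *: 'X - (2 * k)%N%:R%:P + s%:~R%:P).
Proof.
case: k => // k _; rewrite big_shift subn1; apply: eq_bigr => s _.
rewrite mulnS natrD !rmorphD /=; ring.
Qed.

Lemma horner_f (S : {fset int}) k : (0 < k)%N ->
  (f S (k - 1)).[k%:R] = (Pi (shift S 2))%:~R.
Proof.
move=> k_gt0; rewrite f_shift // horner_prod rmorph_prod /=.
by apply: eq_bigr => s _; rewrite !hornerE -natrM subrr add0r.
Qed.

Lemma P_step k : (0 < k)%N ->
  P k.+1 =
      ((P k).[k%:R] *: \prod_(1 <= i < k.+1)
                           (2%:R *: 'X - (2 * k)%N%:R%:P + (2 * i + 1)%N%:R%:P)
       - (\prod_(1 <= i < k.+1) (2 * i + 1)%N%:R) *: P k)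
      %/ (2%:R *: 'X - (2 * k)%N%:R%:P).
Proof. by case: k. Qed.

Lemma P_sum k : (0 < k)%N ->
  P k = \sum_(T : plane_tree k) (wt T)%:~R *: f (Low T) (k - 1).
Proof.
case: k => // k _; elim: k => [|k IH].
  rewrite (big_pred1 (PlaneTree (erefl : nvertices leaf == 1%N))) => [|T] /=.
    by rewrite /f big_nil scale1r.
  apply/esym/eqP/val_inj/level_eq0.
  by have := level_lt T; rewrite plane_treeP ltnS leqn0 => /eqP.
set n := k.+1 in IH *; rewrite P_step //.
rewrite (sum_plane_treeS (fun T => (wt T)%:~R *: f (Low T) (n.+1 - 1))) //.
pose y : {poly rat} := 2%:R *: 'X - (2 * n)%N%:R%:P; rewrite -/y.
have y_neq0 : y != 0.
  apply/eqP => /(congr1 (coefp 1)) /eqP.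
  by rewrite /y /= coefB coefZ coefX coefC coef0.
rewrite (_ : _ - _ = y * \sum_(T : plane_tree n) \sum_(d < (level T).+1)
  (wt (add_last d T))%:~R *: f (Low (add_last d T)) (n.+1 - 1)) ?mulKp //.
rewrite (prod_R (fun s => y + s%:~R%:P)) (prod_R (fun s => s%:~R)).
rewrite IH horner_sum scaler_suml scaler_sumr mulr_sumr -sumrB.
apply: eq_bigr => T _.
have DT := plane_treeP T.
rewrite hornerZ horner_f // f_shift // -[LHS]/(_ - _) -rmorphM /= -/y.
by have := sum_children T y; rewrite DT subn1 /f => ->.
Qed.

Theorem mainTheorem2 (k : nat) (hk : (1 <= k)%N) :
  P k = \sum_(T : plane_tree k) (wt T)%:~R *: f (Low T) (k - 1)
  /\ A k = \sum_(T : plane_tree k) (wt T * Pi (shift (Low T) 2))%:~R.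
Proof.
split; first exact: P_sum.
rewrite /A P_sum // horner_sum; apply: eq_bigr => T _.
by rewrite hornerZ horner_f // rmorphM.
Qed.
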